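(* Let $\rho:\Gamma\to G$ be a $(P^+,P^-)$-Anosov representation, let $M:=\Omega_\rho$ be its domain of discontinuity, and for $g\in\rho(\Gamma)$ let $E^g=g^*TM$, let $\mathcal{D}^{E^g}$ be the space of all connections on $E^g$ and $\mathcal{A}ut(E^g)$ the group of gauge automorphisms of $E^g$. Then $\rho(\Gamma)$ acts properly discontinuously on $\coprod_{g\in\rho(\Gamma)}\mathcal{D}^{E^g}\big/\mathcal{A}ut(E^g)$.
   Context: Anosov representations. $\Gamma$ is a finitely generated word hyperbolic group with boundary $\partial_\infty\Gamma$, and $\partial_\infty\Gamma^{(2)}=\partial_\infty\Gamma\times\partial_\infty\Gamma\setminus\{(t,t)\}$. $G$ is a semisimple Lie group, $(P^+,P^-)$ a pair of opposite parabolic subgroups, $\mathcal{F}^\pm=G/P^\pm$. A pair in $\mathcal{F}^+\times\mathcal{F}^-$ is transverse if it lies in the unique open $G$-orbit of the diagonal action (this orbit is $\cong G/(P^+\cap P^-)$). $\hat\Gamma$ is the (essentially unique) proper hyperbolic metric space with an action of $\Gamma\times(\mathbb{R}\rtimes\mathbb{Z}/2\mathbb{Z})$ such that $\Gamma\times\mathbb{Z}/2\mathbb{Z}$ acts isometrically, every orbit map $\Gamma\to\hat\Gamma$ is a quasi-isometry, the $\mathbb{R}$-action $\phi_t$ is free with quasi-isometrically embedded orbits, and the induced map $(\tau^+,\tau^-):\hat\Gamma/\mathbb{R}\to\partial_\infty\Gamma^{(2)}$ (endpoints of orbits) is a homeomorphism. A representation $\rho:\Gamma\to G$ is $(P^+,P^-)$-Anosov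 if there are continuous $\rho$-equivariant maps $\xi^\pm:\partial_\infty\Gamma\to\mathcal{F}^\pm$ such that (1) $(\xi^+(t^+),\xi^-(t^-))$ is transverse for all $(t^+,t^-)\in\partial_\infty\Gamma^{(2)}$; (2) for one (hence any) continuous equivariant family of norms $\|\cdot\|_{\hat m}$, $\hat m\in\hat\Gamma$, on $T_{\xi^+(\tau^+(\hat m))}\mathcal{F}^+$ (resp. $T_{\xi^-(\tau^-(\hat m))}\mathcal{F}^-$) there are $A,a>0$ with $\|e\|_{\phi_{-t}(\hat m)}\le Ae^{-at}\|e\|_{\hat m}$ (resp. $\|e\|_{\phi_t(\hat m)}\le Ae^{-at}\|e\|_{\hat m}$) for all $t\ge0$, $\hat m$, $e$. Domain of discontinuity. $\mathcal{X}=G/H$ with $H$ a parabolic or a symmetric subgroup of $G$. $M=\Omega_\rho\subset\mathcal{X}$ is a domain of discontinuity for $\rho$: an open $\rho(\Gamma)$-invariant subset such that for every compact $K\subset\Omega_\rho$ the set $\{\gamma\in\Gamma:\rho(\gamma)K\cap K\ne\emptyset\}$ is finite. An action of $\rho(\Gamma)$ on a topological space $X$ is called properly discontinuous if for every compact (not necessarily Hausdorff) $K\subset X$ the set $\{\gamma\in\Gamma:\rho(\gamma)K\cap K\neq\emptyset\}$ is finite. Bundles and actions. Each $g\in\rho(\Gamma)$ acts on $M$ as a diffeomorphism; $E=TM$, $E^g=g^*TM=\{(m,x)\in M\times TM: x\in T_{gm}M\}$. For $g,g'\in\rho(\Gamma)$ there is a vector bundle isomorphism $g:E^{g'}\to E^{gg'}$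 over $\mathrm{id}_M$, given on the fibre over $m$ by $dg|_{g'm}:T_{g'm}M\to T_{gg'm}M$; it acts on bundle-valued forms by $g(\sum\alpha_i\sigma_i)=\sum\alpha_i\,g(\sigma_i)$. If $D$ is a connection on $E^{g'}$, then $gD:=g\circ D\circ g^{-1}$ is a connection on $E^{gg'}$. A gauge automorphism of $E^g$ is a smooth vector bundle automorphism $\tau$ covering $\mathrm{id}_M$; it acts on connections by $\tau\cdot D=\tau\circ D\circ\tau^{-1}$. Since $g\tau g^{-1}\in\mathcal{A}ut(E^{gg'})$ for $\tau\in\mathcal{A}ut(E^{g'})$, the action of $\rho(\Gamma)$ on $\coprod_g\mathcal{D}^{E^g}$ descends to $\coprod_g\mathcal{D}^{E^g}/\mathcal{A}ut(E^g)$. Topology. $\Omega^1(M;\mathrm{End}(E^g))$ has the topology of pointwise convergence, i.e. the subspace topology from the product $\prod_{m\in M}(T^*M\otimes\mathrm{End}(E^g))$ of copies of the total space of the bundle. Fix a connection $D\in\mathcal{D}^{E}$; $\mathcal{D}^{E^g}$ is topologized so that $\Omega^1(M;\mathrm{End}(E^g))\to\mathcal{D}^{E^g}$, $A\mapsto gD+A$, is a homeomorphism. Each $\mathcal{D}^{E^g}/\mathcal{A}ut(E^g)$ has the quotient topology and the coproduct has the disjoint union topology. *)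

(* Defs.v *)
From HB Require Import structures.
From mathcomp Require Import all_boot all_order all_algebra.
From mathcomp Require Import all_classical all_reals all_analysis.
Import numFieldNormedType.Exports.
Import Order.TTheory GRing.Theory Num.Theory.

Set Implicit Arguments.
Unset Strict Implicit.
Unset Printing Implicit Defensive.

Local Open Scope classical_set_scope.
Local Open Scope ring_scope.

Section euclidean.
Context {R : realType} {n : nat}.

(* On an open set, having all directional derivatives of order k, and these
   being continuous, is being of class C^k. *)
Fixpoint class_C (k : nat) (U : set 'rV[R]_n) (f : 'rV[R]_n -> R) : Prop :=
  if k is k'.+1 then
    (forall x v, U x -> derivable f x v) /\
    (forall v, class_C k' U (fun x => 'D_v f x))
  else forall x, U x -> {for x, continuous f}.

Definition class_Cinfty (U : set 'rV[R]_n) (f : 'rV[R]_n -> R) : Prop :=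
  forall k, class_C k U f.

End euclidean.

(* A smooth structure is given by its sheaf of smooth functions:
   [smooth_at f x] means that f is smooth on some neighbourhood of x. *)
HB.mixin Record hasSmooth (R : realType) X of Topological X := {
  smooth_at : (X -> R) -> X -> Prop;
  smooth_at_cst : forall c x, smooth_at (fun=> c) x;
  smooth_atD : forall f g x, smooth_at f x -> smooth_at g x ->
    smooth_at (fun y => f y + g y) x;
  smooth_atM : forall f g x, smooth_at f x -> smooth_at g x ->
    smooth_at (fun y => f y * g y) x;
  smooth_at_near : forall f g x, (\forall y \near x, f y = g y) ->
    smooth_at f x -> smooth_at g x
}.

#[short(type="smoothType")]
HB.structure Definition Smooth (R : realType) := {X of Topological X & hasSmooth R X}.

Definition smooth {R : realType} {X : smoothType R} (f : X -> R) : Prop :=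
  forall x, smooth_at f x.

Section manifold.
Context {R : realType}.

(* Under a chart the smooth functions are the C^infinity functions. *)
Record is_chart {X : smoothType R} {n : nat} (U : set X) (u : X -> 'rV[R]_n) :
    Prop := IsChart {
  chart_open : open U;
  chart_inj : {in U &, injective u};
  chart_homeo : forall V, V `<=` U -> (open V <-> open (u @` V));
  chart_smooth : forall f x, U x ->
    smooth_at f x <->
    exists W h, [/\ open W, W (u x), class_Cinfty W h &
                   forall y, U y -> W (u y) -> f y = h (u y)]
}.

Record is_manifold (X : smoothType R) (n : nat) : Prop := IsManifold {
  manifold_hausdorff : hausdorff_space X;
  manifold_countable : @second_countable X;
  manifold_chart : forall x : X, exists U (u : X -> 'rV[R]_n),
    U x /\ is_chart U u
}.

Definition smooth_at2 {X Y : smoothType R} (f : X -> Y -> R) (x : X) (y : Y) :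
    Prop :=
  exists m n (U : set X) (u : X -> 'rV[R]_m) (V : set Y) (v : Y -> 'rV[R]_n) W h,
  [/\ U x /\ is_chart U u, V y /\ is_chart V v,
      open W /\ W (row_mx (u x) (v y)), class_Cinfty W h &
      forall x' y', U x' -> V y' -> W (row_mx (u x') (v y')) ->
        f x' y' = h (row_mx (u x') (v y'))].

Definition smooth_map {X Y : smoothType R} (F : X -> Y) : Prop :=
  continuous F /\ forall f x, smooth_at f (F x) -> smooth_at (f \o F) x.

End manifold.

(* On an open subset of a manifold this is the open submanifold structure. *)
Section subset_smooth.
Context {R : realType} {X : smoothType R} (A : set X).

Definition sub_smooth_at (f : A -> R) (x : A) : Prop :=
  exists2 F : X -> R, smooth_at F (val x) & forall y : A, f y = F (val y).

Lemma sub_smooth_at_cst c x : sub_smooth_at (fun=> c) x.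
Proof. by exists (fun=> c) => //; exact: smooth_at_cst. Qed.

Lemma sub_smooth_atD f g x : sub_smooth_at f x -> sub_smooth_at g x ->
  sub_smooth_at (fun y => f y + g y) x.
Proof.
move=> [F sF fF] [F' sF' gF']; exists (fun y => F y + F' y) => [|y].
  exact: smooth_atD.
by rewrite fF gF'.
Qed.

Lemma sub_smooth_atM f g x : sub_smooth_at f x -> sub_smooth_at g x ->
  sub_smooth_at (fun y => f y * g y) x.
Proof.
move=> [F sF fF] [F' sF' gF']; exists (fun y => F y * F' y) => [|y].
  exact: smooth_atM.
by rewrite fF gF'.
Qed.

Lemma sub_smooth_at_near f g x : (\forall y \near x, f y = g y) ->
  sub_smooth_at f x -> sub_smooth_at g x.
Proof.
move=> near_fg [F sF fF].
have [B [[W oW WB] Bx] fg] : exists2 B, open_nbhs x B & forall y, B y -> f y = g y.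
  by move: near_fg; rewrite /prop_near1 nbhsE => -[B oB fg]; exists B.
pose F' z := if `[< W z >] then F z else oapp g 0 (insub z : option A).
exists F'; last first.
  move=> y; rewrite /F'; case: asboolP => [Wy|_]; last by rewrite valK.
  by rewrite -fF fg// -WB.
apply: smooth_at_near sF.
have : nbhs (val x) W by apply: open_nbhs_nbhs; split => //; rewrite -WB in Bx.
by apply: filterS => z Wz; rewrite /F' asboolT.
Qed.

HB.instance Definition _ := hasSmooth.Build R (set_type A)
  sub_smooth_at_cst sub_smooth_atD sub_smooth_atM sub_smooth_at_near.

End subset_smooth.

Section quotient_smooth.
Context {R : realType} {X : smoothType R} (Q0 : quotType X).
Local Open Scope quotient_scope.
Local Notation Q := (quotient_topology Q0).

(* For G/H with H closed this is the structure making G -> G/H a submersion. *)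
Definition quot_smooth_at (f : Q -> R) (q : Q) : Prop :=
  forall x : X, \pi_Q x = q -> smooth_at (f \o \pi_Q) x.

Lemma quot_smooth_at_cst c x : quot_smooth_at (fun=> c) x.
Proof. by move=> y _; exact: smooth_at_cst. Qed.

Lemma quot_smooth_atD f g x : quot_smooth_at f x -> quot_smooth_at g x ->
  quot_smooth_at (fun y => f y + g y) x.
Proof. by move=> sf sg y yx; exact: smooth_atD (sf y yx) (sg y yx). Qed.

Lemma quot_smooth_atM f g x : quot_smooth_at f x -> quot_smooth_at g x ->
  quot_smooth_at (fun y => f y * g y) x.
Proof. by move=> sf sg y yx; exact: smooth_atM (sf y yx) (sg y yx). Qed.

Lemma quot_smooth_at_near f g x : (\forall y \near x, f y = g y) ->
  quot_smooth_at f x -> quot_smooth_at g x.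
Proof.
move=> fg sf y yx; apply: smooth_at_near (sf y yx).
move: fg; rewrite -yx => fg.
exact: (@pi_continuous X Q0 y _ fg).
Qed.

HB.instance Definition _ := hasSmooth.Build R Q
  quot_smooth_at_cst quot_smooth_atD quot_smooth_atM quot_smooth_at_near.

End quotient_smooth.

Section tangent.
Context {R : realType} {X : smoothType R}.

(* Tangent vectors are derivations of the algebra of smooth functions; the value
   on a function that is not smooth is meaningless and set to 0, so that equality
   of tangent vectors is equality of derivations. *)
Record derivation_at (x : X) (v : (X -> R) -> R) : Prop := IsDerivation {
  der_junk : forall f, ~ smooth f -> v f = 0;
  der_lin : forall a f g, smooth f -> smooth g ->
    v (fun y => a * f y + g y) = a * v f + v g;
  derM : forall f g, smooth f -> smooth g ->
    v (fun y => f y * g y) = v f * g x + f x * v g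
}.

Definition is_tangent (x : X) : {pred (X -> R) -> R^o} :=
  [pred v | `[< derivation_at x v >]].

Lemma is_tangent_submod x : submod_closed (is_tangent x).
Proof.
split=> [|a u v /asboolP[ju lu mu] /asboolP[jv lv mv]]; apply/asboolP.
  by split=> *; rewrite ?fctE ?mulr0 ?mul0r ?addr0.
split=> [f nf|b f g sf sg|f g sf sg]; rewrite !fctE.
- by rewrite ju// jv// scaler0 addr0.
- by rewrite lu// lv// /GRing.scale/= !mulrDr mulrCA addrACA.
- rewrite mu// mv// /GRing.scale/= !mulrDr !mulrDl mulrA mulrCA.
  by rewrite -!addrA; congr (_ + _); rewrite addrCA.
Qed.

HB.instance Definition _ x :=
  GRing.isSubmodClosed.Build R ((X -> R) -> R^o) (is_tangent x)
    (is_tangent_submod x).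

Record tangent (x : X) := Tangent {
  tval :> (X -> R) -> R^o;
  tvalP : tval \in is_tangent x
}.

HB.instance Definition _ x := [isSub for @tval x].
HB.instance Definition _ x := [Choice of tangent x by <:].
HB.instance Definition _ x := [SubChoice_isSubLmodule of tangent x by <:].

End tangent.

Section smooth_closure.
Context {R : realType} {X : smoothType R}.

Lemma smooth_cst c : smooth ((fun=> c) : X -> R).
Proof. by move=> x; exact: smooth_at_cst. Qed.

Lemma smoothD (f g : X -> R) :
  smooth f -> smooth g -> smooth (fun y => f y + g y).
Proof. by move=> sf sg x; exact: smooth_atD. Qed.

Lemma smoothM (f g : X -> R) :
  smooth f -> smooth g -> smooth (fun y => f y * g y).
Proof. by move=> sf sg x; exact: smooth_atM. Qed.

End smooth_closure.

Record smooth_fun {R : realType} (X : smoothType R) := SmoothFun {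
  sfun :> X -> R;
  sfunP : smooth sfun
}.

Lemma smooth_map_comp {R : realType} {X Y : smoothType R} (F : X -> Y) f :
  smooth_map F -> smooth f -> smooth (f \o F).
Proof. by move=> [_ sF] sf x; exact: sF. Qed.

Record diffeo {R : realType} (X : smoothType R) := Diffeo {
  dfun :> X -> X;
  dinv : X -> X;
  dfunK : cancel dfun dinv;
  dinvK : cancel dinv dfun;
  dfun_smooth : smooth_map dfun;
  dinv_smooth : smooth_map dinv
}.

Definition diffeo_inv {R : realType} {X : smoothType R} (g : diffeo X) :
    diffeo X :=
  Diffeo (dinvK g) (dfunK g) (dinv_smooth g) (dfun_smooth g).

Section differential.
Context {R : realType} {X : smoothType R} (g : diffeo X) (x y : X).
Hypothesis yE : y = g x.

Lemma push_subproof (v : tangent x) : (fun f => v (f \o g)) \in is_tangent y.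
Proof.
have /asboolP[jv lv mv] := tvalP v; apply/asboolP.
split=> [f nf|a f h sf sh|f h sf sh].
- apply: jv => sfg; apply: nf => z.
  by have := smooth_map_comp (dinv_smooth g) sfg z; rewrite (_ : _ \o _ = f)//;
     apply/funext => w /=; rewrite dinvK.
- exact: lv (smooth_map_comp (dfun_smooth g) sf) (smooth_map_comp (dfun_smooth g) sh).
- by rewrite yE; exact: mv (smooth_map_comp (dfun_smooth g) sf) (smooth_map_comp (dfun_smooth g) sh).
Qed.

Definition push (v : tangent x) : tangent y := Tangent (push_subproof v).

Lemma push_linear : linear push.
Proof. by move=> a u v; apply/val_inj; apply/funext. Qed.

End differential.

(* [section phi] is the module of smooth sections of phi^* TM. *)
Section sections.
Context {R : realType} {M : smoothType R} (phi : M -> M).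

Definition is_section : {pred M -> (M -> R) -> R^o} :=
  [pred s | `[< (forall m, s m \in is_tangent (phi m)) /\
               forall f, smooth f -> smooth (fun m => s m f) >]].

Lemma is_section_submod : submod_closed is_section.
Proof.
split=> [|a u v /asboolP[tu su] /asboolP[tv sv]]; apply/asboolP; split=> [m|f sf].
- exact: rpred0.
- exact: smooth_cst.
- exact: (rpredD (rpredZ a (tu m)) (tv m)).
- by apply: smoothD (sv _ sf); apply: smoothM (su _ sf); exact: smooth_cst.
Qed.

HB.instance Definition _ :=
  GRing.isSubmodClosed.Build R (M -> (M -> R) -> R^o) is_section
    is_section_submod.

Record section := Section {
  secval : M -> (M -> R) -> R^o;
  secvalP : secval \in is_section
}.

HB.instance Definition _ := [isSub for secval].
HB.instance Definition _ := [Choice of section by <:].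
HB.instance Definition _ := [SubChoice_isSubLmodule of section by <:].

Lemma section_tangent (s : section) m : secval s m \in is_tangent (phi m).
Proof. by have /asboolP[] := secvalP s. Qed.

Definition sec_at (s : section) m : tangent (phi m) :=
  Tangent (section_tangent s m).

Lemma section_smooth (s : section) f :
  smooth f -> smooth (fun m => sec_at s m f).
Proof. by move=> sf; have /asboolP[_ ss] := secvalP s; exact: ss. Qed.

Lemma mk_section_subproof (s : forall m, tangent (phi m)) :
  (forall f, smooth f -> smooth (fun m => s m f)) ->
  (fun m => s m : (M -> R) -> R^o) \in is_section.
Proof. by move=> ss; apply/asboolP; split=> [m|//]; exact: tvalP. Qed.

Definition mk_section s ss : section := Section (@mk_section_subproof s ss).

Lemma sec_scale_subproof (f : smooth_fun M) (s : section) :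
  forall h, smooth h -> smooth (fun m => (f m *: sec_at s m : tangent _) h).
Proof.
by move=> h sh; apply: smoothM (sfunP f) _; exact: section_smooth.
Qed.

Definition sec_scale (f : smooth_fun M) (s : section) : section :=
  mk_section (sec_scale_subproof f s).

End sections.

Notation vector_field M := (@section _ M idfun).
Coercion sec_at : section >-> Funclass.

Definition vf_app {R : realType} {M : smoothType R} (X : vector_field M)
    (f : smooth_fun M) : smooth_fun M :=
  SmoothFun (section_smooth X (sfunP f)).

Section bundle.
Context {R : realType} {M : smoothType R} (phi : M -> M).

(* Connections on phi^* TM, as covariant derivatives. *)
Record connection := Connection {
  cov :> vector_field M -> section phi -> section phi;
  cov_tensor : forall f X Y s,
    cov (sec_scale f X + Y) s = sec_scale f (cov X s) + cov Y s;
  cov_add : forall X s t, cov X (s + t) = cov X s + cov X t;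
  cov_leibniz : forall X f s,
    cov X (sec_scale f s) = sec_scale (vf_app X f) s + sec_scale f (cov X s)
}.

(* Fibre at m of T^*M (x) End (phi^* TM). *)
Record endo_form (m : M) := EndoForm {
  ef :> tangent m -> tangent (phi m) -> tangent (phi m);
  ef_linear : forall w, linear (ef^~ w);
  ef_linearr : forall v, linear (ef v)
}.

(* Omega^1 (M; End (phi^* TM)) *)
Record one_form := OneForm {
  of_at :> forall m, endo_form m;
  of_smooth : forall (X : vector_field M) (s : section phi) f, smooth f ->
    smooth (fun m => of_at m (X m) (s m) f)
}.

Definition of_app (A : one_form) (X : vector_field M) (s : section phi) :
  section phi := mk_section (of_smooth A X s).

Record gauge := Gauge {
  gau :> forall m, tangent (phi m) -> tangent (phi m);
  gau_inv : forall m, tangent (phi m) -> tangent (phi m);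
  gau_linear : forall m, linear (@gau m);
  gauK : forall m, cancel (@gau m) (@gau_inv m);
  gau_invK : forall m, cancel (@gau_inv m) (@gau m);
  gau_smooth : forall (s : section phi) f, smooth f ->
    smooth (fun m => gau (s m) f);
  gau_inv_smooth : forall (s : section phi) f, smooth f ->
    smooth (fun m => gau_inv (s m) f)
}.

End bundle.

Lemma section_ext {R : realType} {M : smoothType R} (phi : M -> M)
  (s t : section phi) : (forall m, s m = t m) -> s = t.
Proof.
move=> st; apply/val_inj/funext => m.
by have /(congr1 val) := st m.
Qed.

Lemma linear_at0 {R : realType} {U V : lmodType R} (f : U -> V) :
  linear f -> f 0 = 0.
Proof. by move=> fL; have := fL (-1) 0 0; rewrite !scaleN1r !addNr. Qed.

Lemma linear_atZ {R : realType} {U V : lmodType R} (f : U -> V) a u :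
  linear f -> f (a *: u) = a *: f u.
Proof. by move=> fL; have := fL a u 0; rewrite (linear_at0 fL) !addr0. Qed.

Section connection_operations.
Context {R : realType} {M : smoothType R} (phi : M -> M).
Implicit Types (D : connection phi) (A : one_form phi) (t : gauge phi).

Lemma sec_scaleE (f : smooth_fun M) (s : section phi) m :
  sec_scale f s m = f m *: s m.
Proof. exact/val_inj. Qed.

Lemma sec_addE (s s' : section phi) m : (s + s') m = s m + s' m.
Proof. exact/val_inj. Qed.

Lemma of_appE A X s m : of_app A X s m = A m (X m) (s m).
Proof. exact/val_inj. Qed.

Section add_form.
Variables (D : connection phi) (A : one_form phi).
Let E X s := D X s + of_app A X s.

Lemma add_form_tensor f X Y s : E (sec_scale f X + Y) s = sec_scale f (E X s) + E Y s.
Proof.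
apply: section_ext => m; rewrite /E cov_tensor.
rewrite !(sec_addE, sec_scaleE, of_appE).
have -> : (sec_scale f X + Y) m = f m *: X m + Y m by exact/val_inj.
by rewrite ef_linear scalerDr addrACA.
Qed.

Lemma add_form_add X s s' : E X (s + s') = E X s + E X s'.
Proof.
apply: section_ext => m; rewrite /E cov_add !(sec_addE, of_appE).
by have := ef_linearr (A m) (X m) 1 (s m) (s' m); rewrite !scale1r => ->; rewrite addrACA.
Qed.

Lemma add_form_leibniz X f s :
  E X (sec_scale f s) = sec_scale (vf_app X f) s + sec_scale f (E X s).
Proof.
apply: section_ext => m; rewrite /E cov_leibniz.
rewrite !(sec_addE, of_appE, sec_scaleE) scalerDr addrA; congr (_ + _).
exact/linear_atZ/ef_linearr.
Qed.

Definition add_form : connection phi :=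
  Connection add_form_tensor add_form_add add_form_leibniz.

End add_form.

Definition gau_sec t (s : section phi) : section phi := mk_section (gau_smooth t s).
Definition gau_inv_sec t (s : section phi) : section phi :=
  mk_section (gau_inv_smooth t s).

Lemma gau_secE t s m : gau_sec t s m = gau t (s m).
Proof. exact/val_inj. Qed.

Lemma gau_inv_secE t s m : gau_inv_sec t s m = gau_inv t (s m).
Proof. exact/val_inj. Qed.

Lemma gau_inv_linear t m : linear (@gau_inv _ _ _ t m).
Proof.
by move=> a u v; apply: (can_inj (gauK t (m := m))); rewrite gau_linear !gau_invK.
Qed.

Lemma gau_secZD t (f : smooth_fun M) s s' :
  gau_sec t (sec_scale f s + s') = sec_scale f (gau_sec t s) + gau_sec t s'.
Proof.
apply: section_ext => m.
by rewrite !(gau_secE, sec_addE, sec_scaleE) gau_linear.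
Qed.

Lemma gau_inv_secZD t (f : smooth_fun M) s s' :
  gau_inv_sec t (sec_scale f s + s') =
  sec_scale f (gau_inv_sec t s) + gau_inv_sec t s'.
Proof.
apply: section_ext => m.
by rewrite !(gau_inv_secE, sec_addE, sec_scaleE) gau_inv_linear.
Qed.

Lemma gau_secK t s : gau_sec t (gau_inv_sec t s) = s.
Proof. by apply: section_ext => m; rewrite gau_secE gau_inv_secE gau_invK. Qed.

Section gauge_action.
Variables (t : gauge phi) (D : connection phi).
Let E X s := gau_sec t (D X (gau_inv_sec t s)).

Lemma gauge_act_tensor f X Y s :
  E (sec_scale f X + Y) s = sec_scale f (E X s) + E Y s.
Proof. by rewrite /E cov_tensor gau_secZD. Qed.

Let sec1 (s : section phi) : sec_scale (SmoothFun (smooth_cst 1)) s = s.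
Proof. by apply: section_ext => m; rewrite sec_scaleE scale1r. Qed.

Lemma gauge_act_add X s s' : E X (s + s') = E X s + E X s'.
Proof.
by rewrite /E -[s in LHS]sec1 gau_inv_secZD sec1 cov_add -[X in gau_sec t (X + _)]sec1
  gau_secZD sec1.
Qed.

Lemma gauge_act_leibniz X f s :
  E X (sec_scale f s) = sec_scale (vf_app X f) s + sec_scale f (E X s).
Proof.
rewrite /E -[sec_scale f s in LHS]addr0 gau_inv_secZD.
have -> : gau_inv_sec t 0 = 0.
  apply: section_ext => m; rewrite gau_inv_secE.
  have -> : (0 : section phi) m = 0 by exact/val_inj.
  exact/linear_at0/gau_inv_linear.
rewrite addr0 cov_leibniz gau_secZD gau_secK; congr (_ + _).
rewrite -[sec_scale f _ in LHS]addr0 gau_secZD -[RHS]addr0; congr (_ + _).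
apply: section_ext => m; rewrite gau_secE.
have -> : (0 : section phi) m = 0 by exact/val_inj.
exact/linear_at0/gau_linear.
Qed.

Definition gauge_act : connection phi :=
  Connection gauge_act_tensor gauge_act_add gauge_act_leibniz.

End gauge_action.

Lemma connection_ext (D D' : connection phi) :
  (forall X s, D X s = D' X s) -> D = D'.
Proof.
case: D => d d1 d2 d3; case: D' => d' d1' d2' d3' /= dd'.
have E : d = d' by apply/funext => X; apply/funext => s; exact: dd'.
by subst d'; congr Connection; exact: Prop_irrelevance.
Qed.

Definition gauge_equiv : rel (connection phi) :=
  fun D D' => `[< exists t, gauge_act t D = D' >].

Definition gauge_id : gauge phi :=
  @Gauge _ _ phi (fun _ v => v) (fun _ v => v) (fun _ _ _ _ => erefl)
    (fun _ _ => erefl) (fun _ _ => erefl)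
    (@section_smooth _ _ phi) (@section_smooth _ _ phi).

Definition gauge_inv t : gauge phi :=
  Gauge (@gau_inv_linear t) (gau_invK t) (gauK t)
    (gau_inv_smooth t) (gau_smooth t).

Lemma gauge_comp_linear t t' m :
  linear (fun v : tangent (phi m) => gau t (gau t' v)).
Proof. by move=> a u v; rewrite !gau_linear. Qed.

Lemma gauge_comp_smooth t t' (s : section phi) f :
  smooth f -> smooth (fun m => gau t (gau t' (s m)) f).
Proof.
move=> sf; have := section_smooth (gau_sec t (gau_sec t' s)) sf.
by congr smooth; apply/funext => m; rewrite !gau_secE.
Qed.

Definition gauge_comp t t' : gauge phi.
Proof.
refine (@Gauge _ _ phi (fun m v => gau t (gau t' v))
  (fun m v => gau_inv t' (gau_inv t v)) _ _ _ _ _).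
- exact: gauge_comp_linear.
- by move=> m v; rewrite !gauK.
- by move=> m v; rewrite !gau_invK.
- exact: gauge_comp_smooth.
- exact: (gauge_comp_smooth (gauge_inv t') (gauge_inv t)).
Defined.

Lemma gauge_equiv_refl : reflexive gauge_equiv.
Proof.
move=> D; apply/asboolP; exists gauge_id; apply: connection_ext => X s /=.
have E (s' : section phi) : gau_sec gauge_id s' = s'.
  by apply: section_ext => m; rewrite gau_secE.
have E' (s' : section phi) : gau_inv_sec gauge_id s' = s'.
  by apply: section_ext => m; rewrite gau_inv_secE.
by rewrite E E'.
Qed.

Lemma gauge_equiv_inv D D' : gauge_equiv D D' -> gauge_equiv D' D.
Proof.
move=> /asboolP[t <-]; apply/asboolP; exists (gauge_inv t).
apply: connection_ext => X s /=; apply: section_ext => m.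
rewrite gau_secE gau_secE /= gauK; congr (sec_at (D X _) m).
by apply: section_ext => m'; rewrite !gau_inv_secE /= gauK.
Qed.

Lemma gauge_equiv_sym : symmetric gauge_equiv.
Proof. by move=> D D'; apply/idP/idP; exact: gauge_equiv_inv. Qed.

Lemma gauge_equiv_trans : transitive gauge_equiv.
Proof.
move=> D' D D'' /asboolP[t <-] /asboolP[t' <-]; apply/asboolP.
exists (gauge_comp t' t); apply: connection_ext => X s /=; apply: section_ext => m.
rewrite !gau_secE /=; congr (gau t' (gau t (sec_at (D X _) m))).
by apply: section_ext => m'; rewrite !gau_inv_secE.
Qed.

End connection_operations.

Section push.
Context {R : realType} {M : smoothType R} (g : diffeo M) (phi chi : M -> M).
Hypothesis chiE : forall m, chi m = g (phi m).

Lemma pull_eq m : phi m = diffeo_inv g (chi m).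
Proof. by rewrite chiE /= dfunK. Qed.

Lemma push_sec_subproof (s : section phi) f :
  smooth f -> smooth (fun m => push (chiE m) (s m) f).
Proof.
by move=> sf; apply: section_smooth; exact: smooth_map_comp (dfun_smooth g) sf.
Qed.

Definition push_sec (s : section phi) : section chi :=
  mk_section (push_sec_subproof s).

Lemma push_secE s m : push_sec s m = push (chiE m) (s m).
Proof. exact/val_inj. Qed.

Lemma push_secZD (f : smooth_fun M) s s' :
  push_sec (sec_scale f s + s') = sec_scale f (push_sec s) + push_sec s'.
Proof.
apply: section_ext => m.
by rewrite !(push_secE, sec_addE, sec_scaleE) push_linear.
Qed.

Lemma push_secZ (f : smooth_fun M) s :
  push_sec (sec_scale f s) = sec_scale f (push_sec s).
Proof.
apply: section_ext => m; rewrite !(push_secE, sec_scaleE).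
exact/linear_atZ/push_linear.
Qed.

Lemma push_secD s s' : push_sec (s + s') = push_sec s + push_sec s'.
Proof.
apply: section_ext => m; rewrite !(push_secE, sec_addE).
by have := push_linear (chiE m) 1 (s m) (s' m); rewrite !scale1r.
Qed.

End push.

Section push_connection.
Context {R : realType} {M : smoothType R} (g : diffeo M) (phi chi : M -> M).
Hypothesis chiE : forall m, chi m = g (phi m).

Definition pull_sec : section chi -> section phi := push_sec (pull_eq chiE).

Lemma pull_secK : cancel pull_sec (push_sec chiE).
Proof.
move=> s; apply: section_ext => m; apply/val_inj/funext => f /=.
by congr (s m _); apply/funext => x /=; rewrite dinvK.
Qed.

Lemma push_secK : cancel (push_sec chiE) pull_sec.
Proof.
move=> s; apply: section_ext => m; apply/val_inj/funext => f /=.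
by congr (s m _); apply/funext => x /=; rewrite dfunK.
Qed.

Variable D : connection phi.
Let E X s := push_sec chiE (D X (pull_sec s)).

Lemma push_conn_tensor f X Y s :
  E (sec_scale f X + Y) s = sec_scale f (E X s) + E Y s.
Proof. by rewrite /E cov_tensor push_secZD. Qed.

Lemma push_conn_add X s s' : E X (s + s') = E X s + E X s'.
Proof. by rewrite /E /pull_sec push_secD cov_add push_secD. Qed.

Lemma push_conn_leibniz X f s :
  E X (sec_scale f s) = sec_scale (vf_app X f) s + sec_scale f (E X s).
Proof. by rewrite /E /pull_sec push_secZ cov_leibniz push_secZD pull_secK push_secZ. Qed.

Definition push_conn : connection chi :=
  Connection push_conn_tensor push_conn_add push_conn_leibniz.

End push_connection.

Section push_gauge.
Context {R : realType} {M : smoothType R} (g : diffeo M) (phi chi : M -> M).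
Hypothesis chiE : forall m, chi m = g (phi m).
Variable t : gauge phi.

Lemma pushK m : cancel (push (chiE m)) (push (pull_eq chiE m)).
Proof.
move=> v; apply/val_inj/funext => f /=; congr (v _).
by apply/funext => x /=; rewrite dfunK.
Qed.

Lemma pullK m : cancel (push (pull_eq chiE m)) (push (chiE m)).
Proof.
move=> v; apply/val_inj/funext => f /=; congr (v _).
by apply/funext => x /=; rewrite dinvK.
Qed.

Definition push_gauge : gauge chi.
Proof.
refine (@Gauge _ _ chi
  (fun m v => push (chiE m) (gau t (push (pull_eq chiE m) v)))
  (fun m v => push (chiE m) (gau_inv t (push (pull_eq chiE m) v))) _ _ _ _ _).
- by move=> m a u v; rewrite !(push_linear, gau_linear).
- by move=> m v; rewrite pushK gauK pullK.
- by move=> m v; rewrite pushK gau_invK pullK.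
- move=> s f sf.
  have := section_smooth (push_sec chiE (gau_sec t (pull_sec chiE s))) sf.
  by congr smooth; apply/funext => m; rewrite push_secE gau_secE push_secE.
- move=> s f sf.
  have := section_smooth (push_sec chiE (gau_inv_sec t (pull_sec chiE s))) sf.
  by congr smooth; apply/funext => m; rewrite push_secE gau_inv_secE push_secE.
Defined.

Lemma push_gauge_act D :
  push_conn chiE (gauge_act t D) = gauge_act push_gauge (push_conn chiE D).
Proof.
apply: connection_ext => X s; apply: section_ext => m /=.
rewrite push_secE !gau_secE /= push_secE pushK.
congr (push _ (gau t (sec_at (D X _) m))).
apply: section_ext => m'.
by rewrite gau_inv_secE !push_secE gau_inv_secE /= pushK.
Qed.

End push_gauge.

Section form_topology.
Context {R : realType} {M : smoothType R} (phi : M -> M).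

HB.instance Definition _ m := gen_eqMixin (endo_form phi m).
HB.instance Definition _ m := gen_choiceMixin (endo_form phi m).
HB.instance Definition _ := gen_eqMixin (smooth_fun M).
HB.instance Definition _ := gen_choiceMixin (smooth_fun M).
HB.instance Definition _ := gen_eqMixin (one_form phi).
HB.instance Definition _ := gen_choiceMixin (one_form phi).

(* The total space of T^*M (x) End (phi^* TM). Every smooth local frame of TM or
   phi^* TM extends, after shrinking, to global sections, and every local
   coordinate to a global function: its bundle topology is thus the coarsest one
   for which the projection to M and the functions (m, B) |-> B(X_m, s_m)(f)
   are continuous. *)
Definition form_coords (p : {m : M & endo_form phi m}) :
    M * {ptws vector_field M * section phi * smooth_fun M -> R^o} :=
  (projT1 p, fun c : vector_field M * section phi * smooth_fun M => projT2 p (c.1.1 (projT1 p)) (c.1.2 (projT1 p)) c.2).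

Definition form_bundle : topologicalType := initial_topology form_coords.

(* Pointwise convergence: a subspace of the product of copies of the bundle. *)
Definition form_values (A : one_form phi) : {ptws M -> form_bundle} :=
  fun m => existT _ m (A m).

Definition one_form_space : topologicalType := initial_topology form_values.

End form_topology.

(* [connection_space D0] is the space of all connections, with the topology for
   which A |-> D0 + A is a homeomorphism from the space of one-forms; as this map
   is a bijection, it is the final topology for it. *)
Definition connection_space {R : realType} {M : smoothType R} {phi : M -> M}
  (D0 : connection phi) : Type := connection phi.

Section connection_topology.
Context {R : realType} {M : smoothType R} (phi : M -> M) (D0 : connection phi).

HB.instance Definition _ := gen_eqMixin (connection_space D0).
HB.instance Definition _ := gen_choiceMixin (connection_space D0).

Definition conn_open (U : set (connection_space D0)) : Prop :=
  open ((fun A : one_form_space phi => add_form D0 A) @^-1` U).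

Lemma conn_openT : conn_open setT.
Proof. by rewrite /conn_open preimage_setT; exact: openT. Qed.

Lemma conn_openI U V : conn_open U -> conn_open V -> conn_open (U `&` V).
Proof. by move=> oU oV; rewrite /conn_open preimage_setI; exact: openI. Qed.

Lemma conn_open_bigU (I : Type) (U : I -> set (connection_space D0)) :
  (forall i, conn_open (U i)) -> conn_open (\bigcup_i U i).
Proof. by move=> oU; rewrite /conn_open preimage_bigcup; apply: bigcup_open => i _; exact: oU. Qed.

HB.instance Definition _ := isOpenTopological.Build (connection_space D0)
  conn_openT conn_openI conn_open_bigU.

Definition connection_rel : rel (connection_space D0) := @gauge_equiv _ _ phi.

Canonical connection_equiv := EquivRel connection_rel
  (@gauge_equiv_refl _ _ phi) (@gauge_equiv_sym _ _ phi)
  (@gauge_equiv_trans _ _ phi).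

Definition moduli : topologicalType :=
  quotient_topology {eq_quot connection_rel}%qT.

Definition gauge_class (D : connection_space D0) : moduli :=
  (\pi_(quotient_topology {eq_quot connection_rel}%qT) D)%qT.

Lemma gauge_classP D D' : gauge_class D = gauge_class D' <-> gauge_equiv D D'.
Proof.
have P := eqmodP connection_equiv D D'.
by split=> [DD'|DD']; [exact: (introT P DD')|exact: (elimT P DD')].
Qed.

Definition gauge_repr (q : moduli) : connection phi :=
  repr (q : quotient_topology {eq_quot connection_rel}%qT).

Lemma gauge_reprK q : gauge_class (gauge_repr q) = q.
Proof. exact: reprK. Qed.

End connection_topology.

Arguments gauge_class {R M phi} D0 D.

HB.mixin Record isLieGroup (R : realType) G of Smooth R G & Group G := {
  lie_dim : nat;
  lie_manifold : is_manifold G lie_dim;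
  mulg_continuous : continuous (fun p : G * G => (p.1 * p.2)%g);
  mulg_smooth : forall (f : G -> R) (x y : G), smooth_at f (x * y)%g ->
    smooth_at2 (fun x' y' : G => f (x' * y')%g) x y;
  invg_smooth : smooth_map (fun x : G => x^-1%g)
}.

#[short(type="lieGroupType")]
HB.structure Definition LieGroup (R : realType) :=
  {G of Smooth R G & Group G & isLieGroup R G}.

Record subgroup (G : groupType) := Subgroup {
  sgset :> set G;
  sg1 : sgset 1%g;
  sgM : forall x y, sgset x -> sgset y -> sgset (x * y)%g;
  sgV : forall x, sgset x -> sgset x^-1%g
}.

Section partial_smooth.
Context {R : realType}.

Lemma row_mx_continuous m n (c : 'rV[R]_m) :
  continuous (fun w : 'rV[R]_n => row_mx c w).
Proof.
move=> w A [P nP PA]; rewrite nbhs_filterE.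
exists (fun i j => P i (rshift m j)) => [i j|w' Pw'].
  by have := nP i (rshift m j); rewrite row_mxEr.
apply: PA => i j; case: (splitP j) => k kE.
  have -> : j = lshift n k by exact/val_inj.
  by rewrite row_mxEl; have /nbhs_singleton := nP i (lshift n k); rewrite row_mxEl.
have -> : j = rshift m k by exact/val_inj.
by rewrite row_mxEr; exact: Pw'.
Qed.

Lemma row_mx_quotient m n (c : 'rV[R]_m) (h : 'rV[R]_(m + n) -> R)
    (x v : 'rV[R]_n) :
  (fun t : R => t^-1 *: (((fun w => h (row_mx c w)) \o shift x) (t *: v)
                         - h (row_mx c x))) =
  (fun t : R => t^-1 *: ((h \o shift (row_mx c x)) (t *: row_mx 0 v)
                         - h (row_mx c x))).
Proof.
by apply/funext => t /=; rewrite scale_row_mx add_row_mx scaler0 add0r.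
Qed.

Lemma class_C_row_mx k m n (c : 'rV[R]_m) W (h : 'rV[R]_(m + n) -> R) :
  class_C k W h ->
  class_C k [set w : 'rV[R]_n | W (row_mx c w)] (fun w => h (row_mx c w)).
Proof.
elim: k h => [|k IHk] h /=.
  move=> hC x Wx; apply: (@continuous_comp _ _ _ (row_mx c) h).
    exact: row_mx_continuous.
  exact: hC.
move=> [hD hC]; split=> [x v Wx|v].
  by rewrite /derivable row_mx_quotient; exact: hD.
have := IHk _ (hC (row_mx 0 v)).
congr class_C; apply/funext => x.
by rewrite /derive row_mx_quotient.
Qed.

Lemma smooth_at2_right (X Y : smoothType R) (f : X -> Y -> R) x y :
  smooth_at2 f x y -> smooth_at (f x) y.
Proof.
move=> [m [n [U [u [V [v [W [h [[Ux _] [Vy cV] [oW Wxy] hC fh]]]]]]]]].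
apply/(chart_smooth cV _ Vy).
exists [set w | W (row_mx (u x) w)], (fun w => h (row_mx (u x) w)); split => //.
- have /continuousP := @row_mx_continuous m n (u x).
  exact.
- by move=> k; exact: class_C_row_mx.
- by move=> y' Vy' Wy'; exact: fh.
Qed.

End partial_smooth.

Section translations.
Context {R : realType} {G : lieGroupType R}.

Lemma mulg_left_smooth (x : G) : smooth_map (fun y => x * y)%g.
Proof.
split=> [y|f y sf].
  apply: (@continuous_comp _ _ _ (fun y => (x, y)) (fun p : G * G => p.1 * p.2)%g).
    by apply: cvg_pair => //=; exact: cvg_cst.
  exact: mulg_continuous.
apply: (@smooth_at2_right _ G G (fun x' y' => f (x' * y')%g)).
exact: mulg_smooth.
Qed.

End translations.

Section homogeneous.
Context {R : realType} {G : lieGroupType R} (H : subgroup G).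

Definition coset_rel : rel G := fun x y => `[< sgset H (x^-1 * y)%g >].

Lemma coset_rel_refl : reflexive coset_rel.
Proof. by move=> x; apply/asboolP; rewrite mulVg; exact: sg1. Qed.

Lemma coset_rel_inv x y : coset_rel x y -> coset_rel y x.
Proof.
by move=> /asboolP/sgV Hxy; apply/asboolP; rewrite invgM invgK in Hxy.
Qed.

Lemma coset_rel_sym : symmetric coset_rel.
Proof. by move=> x y; apply/idP/idP; exact: coset_rel_inv. Qed.

Lemma coset_rel_trans : transitive coset_rel.
Proof.
move=> y x z /asboolP Hxy /asboolP Hyz; apply/asboolP.
by have := sgM Hxy Hyz; rewrite -mulgA mulVKg.
Qed.

Canonical coset_equiv :=
  EquivRel coset_rel coset_rel_refl coset_rel_sym coset_rel_trans.

Definition homogeneous : smoothType R :=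
  quotient_topology {eq_quot coset_rel}%qT.

Definition coset_of (x : G) : homogeneous :=
  (\pi_(quotient_topology {eq_quot coset_rel}) x)%qT.

Definition hact (g : G) (q : homogeneous) : homogeneous :=
  coset_of (g * repr q)%g.

Lemma coset_ofP x y : coset_of x = coset_of y <-> sgset H (x^-1 * y)%g.
Proof.
have P := eqmodP coset_equiv x y.
split=> [xy|xy]; first by apply/asboolP; exact: (introT P xy).
by apply: (elimT P); exact/asboolP.
Qed.

Lemma coset_of_repr q : coset_of (repr q) = q.
Proof. exact: reprK. Qed.

Lemma hact_coset g x : hact g (coset_of x) = coset_of (g * x)%g.
Proof.
apply/coset_ofP; rewrite invgM -mulgA mulKg.
by apply/coset_ofP; rewrite coset_of_repr.
Qed.

Lemma hact1 q : hact 1%g q = q.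
Proof. by rewrite /hact mul1g coset_of_repr. Qed.

Lemma hactM g g' q : hact (g * g')%g q = hact g (hact g' q).
Proof. by rewrite -[q]coset_of_repr !hact_coset mulgA. Qed.

Lemma hactK g : cancel (hact g) (hact g^-1%g).
Proof. by move=> q; rewrite -hactM mulVg hact1. Qed.

Lemma hactVK g : cancel (hact g^-1%g) (hact g).
Proof. by move=> q; rewrite -hactM mulgV hact1. Qed.

Lemma hact_smooth g : smooth_map (hact g).
Proof.
have E : hact g \o coset_of = coset_of \o (fun x => g * x)%g.
  by apply/funext => x /=; rewrite hact_coset.
have [cL sL] := mulg_left_smooth g.
split.
  apply/quotient_continuous; rewrite -/coset_of E => x.
  apply: continuous_comp; first exact: cL.
  exact: pi_continuous.
move=> f q sf x xq; rewrite -/coset_of in xq *.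
rewrite -compA E compA; apply: sL; apply: sf.
by rewrite -xq hact_coset.
Qed.

Definition hact_diffeo g : diffeo homogeneous :=
  Diffeo (hactK g) (hactVK g) (hact_smooth g) (hact_smooth g^-1%g).

End homogeneous.

Section lie_algebra.
Context {R : realType} (G : lieGroupType R).
Implicit Types (v w X : (G -> R) -> R^o) (S I : set ((G -> R) -> R^o)).

Definition lie : set ((G -> R) -> R^o) := [set v | v \in is_tangent (1%g : G)].

(* The left-invariant vector field of v is (L_v f)(x) = v (y |-> f (x y)), and
   [v, w] f = v (L_w f) - w (L_v f). *)
Definition bracket v w : (G -> R) -> R^o := fun f =>
  v (fun x => w (fun y => f (x * y)%g)) - w (fun x => v (fun y => f (x * y)%g)).

Definition Ad (g : G) v : (G -> R) -> R^o :=
  fun f => v (fun x => f (g * x * g^-1)%g).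

Definition is_subspace S : Prop :=
  S 0 /\ forall a u v, S u -> S v -> S (a *: u + v).

Definition lspan S : set ((G -> R) -> R^o) := smallest is_subspace S.

Definition is_ideal I : Prop :=
  [/\ is_subspace I, I `<=` lie & forall v w, lie v -> I w -> I (bracket v w)].

Definition derived I : set ((G -> R) -> R^o) :=
  lspan [set u | exists v w, [/\ I v, I w & u = bracket v w]].

Definition solvable I : Prop := exists k, iter k derived I `<=` [set 0].

Definition semisimple : Prop :=
  forall I, is_ideal I -> solvable I -> I `<=` [set 0].

Definition weight_space X (a : R) : set ((G -> R) -> R^o) :=
  [set v | lie v /\ bracket X v = a *: v].

Definition weight_sum X (J : set R) : set ((G -> R) -> R^o) :=
  lspan (\bigcup_(a in J) weight_space X a).

Definition real_diagonalizable X : Prop := lie X /\ weight_sum X setT = lie.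

Definition normalizer S : set G := [set g | Ad g @` S = S].

(* Parabolic subgroups are the normalizers of the parabolic subalgebras; the
   latter are the sums of the eigenspaces with nonnegative eigenvalues of some
   ad X as above (X in a closed Weyl chamber of a Cartan subspace, the simple
   roots not vanishing at X being those removed from the Levi factor); the
   nonpositive eigenvalues give the opposite one. *)
Definition opposite_parabolics (Pp Pm : subgroup G) : Prop :=
  exists X, [/\ real_diagonalizable X,
    sgset Pp = normalizer (weight_sum X [set a | 0 <= a]) &
    sgset Pm = normalizer (weight_sum X [set a | a <= 0])].

Definition parabolic (P : subgroup G) : Prop :=
  exists X, real_diagonalizable X /\
    sgset P = normalizer (weight_sum X [set a | 0 <= a]).

(* Subgroups between the fixed points of an involution and their identity
   component. *)
Definition symmetric_subgroup (H : subgroup G) : Prop :=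
  exists s : G -> G,
    [/\ {morph s : x y / (x * y)%g}, involutive s, smooth_map s,
        connected_component [set x | s x = x] 1%g `<=` sgset H &
        sgset H `<=` [set x | s x = x]].

End lie_algebra.

Section coarse_geometry.
Context {R : realType}.

Definition gromov_product {T : Type} (d : T -> T -> R) (w x y : T) : R :=
  (d x w + d y w - d x y) / 2.

Definition gromov_hyperbolic {T : Type} (d : T -> T -> R) : Prop :=
  exists delta, forall w x y z,
    Num.min (gromov_product d w x y) (gromov_product d w y z) - delta
      <= gromov_product d w x z.

Definition qi_embedding {S T : Type} (dS : S -> S -> R) (dT : T -> T -> R)
    (f : S -> T) : Prop :=
  exists c k, 1 <= c /\ forall x y,
    c^-1 * dS x y - k <= dT (f x) (f y) <= c * dS x y + k.

Definition quasi_isometry {S T : Type} (dS : S -> S -> R) (dT : T -> T -> R)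
    (f : S -> T) : Prop :=
  qi_embedding dS dT f /\ exists k, forall y, exists x, dT (f x) y <= k.

(* The Gromov products of the terms of the two sequences tend to infinity. This
   does not depend on the base point. *)
Definition asymptotic {T : Type} (d : T -> T -> R) (x y : nat -> T) : Prop :=
  forall w A, exists N, forall i j, (N <= i)%N -> (N <= j)%N ->
    A <= gromov_product d w (x i) (y j).

End coarse_geometry.

Section hyperbolic_group.
Context {R : realType} {Gam : groupType} (S : seq Gam).

Definition is_word (n : nat) (x : Gam) : Prop :=
  exists w : seq Gam, [/\ size w = n,
    forall s, s \in w -> (s \in S) || (s^-1%g \in S) &
    x = (\prod_(s <- w) s)%g].

Definition generates : Prop := forall x, exists n, is_word n x.

Definition word_dist (x y : Gam) : R :=
  inf [set n%:R | n in [set n | is_word n (x^-1 * y)%g]].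

Definition hyperbolic_group : Prop := generates /\ gromov_hyperbolic word_dist.

Lemma word_dist_translate g x y : word_dist (g * x)%g (g * y)%g = word_dist x y.
Proof. by rewrite /word_dist invgM -mulgA mulKg. Qed.

Definition converges_at_infinity (x : nat -> Gam) : Prop :=
  asymptotic word_dist x x.

Record boundary := Boundary {
  bset : set (nat -> Gam);
  bsetP : exists x, converges_at_infinity x /\
    bset = [set y | converges_at_infinity y /\ asymptotic word_dist x y]
}.

HB.instance Definition _ := gen_eqMixin boundary.
HB.instance Definition _ := gen_choiceMixin boundary.

Definition boundary_near (p : boundary) (r : R) : set boundary :=
  [set q | exists x y, [/\ bset p x, bset q y &
    exists N, forall i j, (N <= i)%N -> (N <= j)%N ->
      r <= gromov_product word_dist 1%g (x i) (y j)]].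

Definition boundary_open (U : set boundary) : Prop :=
  forall p, U p -> exists r, boundary_near p r `<=` U.

Lemma boundary_openT : boundary_open setT.
Proof. by move=> p _; exists 0. Qed.

Lemma boundary_near_le p r r' : r <= r' ->
  boundary_near p r' `<=` boundary_near p r.
Proof.
move=> rr' q [x [y [px qy [N xy]]]]; exists x, y; split => //.
by exists N => i j Ni Nj; exact: le_trans rr' (xy i j Ni Nj).
Qed.

Lemma boundary_openI U V :
  boundary_open U -> boundary_open V -> boundary_open (U `&` V).
Proof.
move=> oU oV p [Up Vp]; have [r rU] := oU p Up; have [r' rV] := oV p Vp.
exists (Num.max r r') => q pq; split.
  by apply: rU; apply: boundary_near_le pq; rewrite le_max lexx.
by apply: rV; apply: boundary_near_le pq; rewrite le_max lexx orbT.
Qed.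

Lemma boundary_open_bigU (I : Type) (U : I -> set boundary) :
  (forall i, boundary_open (U i)) -> boundary_open (\bigcup_i U i).
Proof.
move=> oU p [i _ Up]; have [r rU] := oU i p Up.
by exists r => q /rU Uq; exists i.
Qed.

HB.instance Definition _ := isOpenTopological.Build boundary
  boundary_openT boundary_openI boundary_open_bigU.

Lemma asymptotic_translate (g : Gam) (x y : nat -> Gam) : asymptotic word_dist x y ->
  asymptotic word_dist (fun n => g * x n)%g (fun n => g * y n)%g.
Proof.
move=> xy w A; have [N xyN] := xy (g^-1 * w)%g A; exists N => i j Ni Nj.
apply: le_trans (xyN i j Ni Nj) _; rewrite le_eqVlt; apply/orP; left.
rewrite /gromov_product -(word_dist_translate g (x i)).
by rewrite -(word_dist_translate g (y j)) -(word_dist_translate g (x i) (y j)) mulVKg.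
Qed.

Lemma asymptotic_translateV (g : Gam) (x y : nat -> Gam) :
  asymptotic word_dist x (fun n => g^-1 * y n)%g ->
  asymptotic word_dist (fun n => g * x n)%g y.
Proof.
move=> /(asymptotic_translate g).
by congr asymptotic; apply/funext => n; rewrite mulVKg.
Qed.

Lemma boundary_act_subproof g (p : boundary) :
  exists x, converges_at_infinity x /\
    [set y | bset p (fun n => g^-1 * y n)%g] =
    [set y | converges_at_infinity y /\ asymptotic word_dist x y].
Proof.
have [x [xoo ->]] := bsetP p.
exists (fun n => g * x n)%g; split; first exact: asymptotic_translate.
apply/seteqP; split=> y /= [yoo xy]; split.
- move: (asymptotic_translate g yoo); rewrite /converges_at_infinity.
  by congr asymptotic; apply/funext => n; rewrite mulVKg.
- exact: asymptotic_translateV.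
- exact: asymptotic_translate.
- move: (asymptotic_translate g^-1%g xy).
  by congr asymptotic; apply/funext => n; rewrite mulKg.
Qed.

Definition boundary_act g (p : boundary) : boundary :=
  Boundary (boundary_act_subproof g p).

Record flow_space := FlowSpace {
  fs_space :> metricType R;
  fs_proper : forall (x : fs_space) r, compact [set y | mdist x y <= r];
  fs_hyperbolic : gromov_hyperbolic (@mdist R fs_space);
  fs_act : Gam -> fs_space -> fs_space;
  flow : R -> fs_space -> fs_space;
  flip : fs_space -> fs_space;
  fs_act1 : fs_act 1%g =1 id;
  fs_actM : forall g h m, fs_act (g * h)%g m = fs_act g (fs_act h m);
  flow0 : flow 0 =1 id;
  flowD : forall s t m, flow (s + t) m = flow s (flow t m);
  flipK : involutive flip;
  flip_flow : forall t m, flip (flow t m) = flow (- t) (flip m);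
  fs_act_flow : forall g t m, fs_act g (flow t m) = flow t (fs_act g m);
  fs_act_flip : forall g m, fs_act g (flip m) = flip (fs_act g m);
  fs_act_isometry : forall g x y, mdist (fs_act g x) (fs_act g y) = mdist x y;
  flip_isometry : forall x y, mdist (flip x) (flip y) = mdist x y;
  fs_orbit : forall m,
    quasi_isometry word_dist (@mdist R fs_space) (fun g => fs_act g m);
  flow_free : forall t m, flow t m = m -> t = 0;
  flow_qi : forall m,
    qi_embedding (fun s t : R => `|s - t|) (@mdist R fs_space) (fun t => flow t m);
  (* The endpoints of the flow lines, the boundary of the space being identified
     with that of the group by the orbit maps. *)
  endp : fs_space -> boundary;
  endm : fs_space -> boundary;
  endpP : forall m x, bset (endp m) x ->
    asymptotic (@mdist R fs_space) (fun n => fs_act (x n) m) (fun n => flow n%:R m);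
  endmP : forall m x, bset (endm m) x ->
    asymptotic (@mdist R fs_space) (fun n => fs_act (x n) m) (fun n => flow (- n%:R) m);
  (* The endpoints induce a homeomorphism from the space of flow lines, with the
     quotient topology, to the pairs of distinct boundary points. *)
  ends_continuous : continuous (fun m => (endp m, endm m));
  ends_inj : forall m m', endp m = endp m' -> endm m = endm m' ->
    exists t, m' = flow t m;
  ends_flow : forall t m, endp (flow t m) = endp m /\ endm (flow t m) = endm m;
  ends_range : range (fun m => (endp m, endm m)) = [set p | p.1 <> p.2];
  ends_open : forall V : set fs_space, open V -> (forall t m, V m -> V (flow t m)) ->
    exists O : set (boundary * boundary), open O /\
      [set (endp m, endm m) | m in V] = O `&` [set p | p.1 <> p.2]
}.

End hyperbolic_group.

Section tangent_bundle.
Context {R : realType} {X : smoothType R}.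

(* The topology of TX is the coarsest one making the projection and the
   differentials of the smooth functions continuous. *)
Definition tangent_coords (p : {x : X & tangent x}) :
    X * {ptws smooth_fun X -> R^o} :=
  (projT1 p, fun f : smooth_fun X => projT2 p f).

Definition tangent_bundle : topologicalType := initial_topology tangent_coords.

(* The pullback of TX by f, as a subspace of T * TX. *)
Definition pullback_inj {T : topologicalType} (f : T -> X)
    (p : {t : T & tangent (f t)}) : T * tangent_bundle :=
  (projT1 p, existT _ (f (projT1 p)) (projT2 p)).

Definition pullback_bundle {T : topologicalType} (f : T -> X) :
  topologicalType := initial_topology (pullback_inj (f := f)).

End tangent_bundle.

Section anosov.
Context {R : realType} {G : lieGroupType R} {Gam : groupType} {S : seq Gam}.
Context (rho : {multiplicative Gam -> G}) (X : @flow_space R Gam S).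

Section norms.
Context {P : subgroup G} (f : X -> homogeneous P).

Record equivariant_norms (N : forall m, tangent (f m) -> R) : Prop := EquivariantNorms {
  norm_eq0 : forall m e, N m e = 0 -> e = 0;
  normZ : forall m a e, N m (a *: e) = `|a| * N m e;
  norm_triangle : forall m e e', N m (e + e') <= N m e + N m e';
  norm_continuous :
    continuous (fun p : pullback_bundle f => N (projT1 p) (projT2 p));
  (* e' is the image of e under the differential of rho g *)
  norm_equivariant : forall g m (e : tangent (f m)) (e' : tangent (f (fs_act g m))),
    (forall h, e' h = e (h \o hact (rho g))) -> N _ e' = N _ e
}.

(* e' is e seen in the tangent space at f (psi t m) = f m. *)
Definition contracting (psi : R -> X -> X) : Prop :=
  exists N, equivariant_norms N /\
    exists A a, [/\ 0 < A, 0 < a &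
      forall t m (e : tangent (f m)) (e' : tangent (f (psi t m))), 0 <= t ->
        tval e' = tval e -> N _ e' <= A * expR (- a * t) * N _ e].

End norms.

Definition transverse (Pp Pm : subgroup G) (x : homogeneous Pp) (y : homogeneous Pm) :
    Prop :=
  open (range (fun g : G => (hact g x, hact g y))).

Definition anosov (Pp Pm : subgroup G) : Prop :=
  exists (xip : @boundary R Gam S -> homogeneous Pp)
         (xim : @boundary R Gam S -> homogeneous Pm),
  [/\ continuous xip /\ continuous xim,
      forall g p, xip (boundary_act g p) = hact (rho g) (xip p) /\
                  xim (boundary_act g p) = hact (rho g) (xim p),
      forall p q, p <> q -> transverse (xip p) (xim q),
      contracting (fun m => xip (endp m)) (fun t => flow (- t)) &
      contracting (fun m => xim (endm m)) (fun t => flow t)].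

End anosov.

Definition properly_discontinuous {Gam : Type} {T : topologicalType}
    (act : Gam -> T -> T) : Prop :=
  forall K : set T, compact K ->
    finite_set [set g | act g @` K `&` K !=set0].

Section restriction.
Context {R : realType} {X : smoothType R} (A : set X) (F : X -> X) (f : A -> A).
Hypothesis fF : forall x, val (f x) = F (val x).

Lemma restrict_smooth : smooth_map F -> smooth_map f.
Proof.
move=> [cF sF]; split.
  apply/continuousP => _ [B oB <-].
  exists (F @^-1` B); first by move/continuousP: cF; exact.
  by apply/seteqP; split=> x /=; rewrite !set_valE /= fF.
move=> h x [H sH hH]; exists (H \o F); first by apply: sF; rewrite -fF.
by move=> y /=; rewrite hH fF.
Qed.

End restriction.

Section domain.
Context {R : realType} {G : lieGroupType R} {Gam : groupType}.
Context (rho : {multiplicative Gam -> G}) (H : subgroup G).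

Record domain := Domain {
  dom :> set (homogeneous H);
  dom_open : open dom;
  dom_inv : forall g q, dom q -> dom (hact (rho g) q);
  dom_finite : forall K, compact K -> K `<=` dom ->
    finite_set [set g | hact (rho g) @` K `&` K !=set0]
}.

Definition image_grp : set G := range rho.

Lemma image_mulP (h g : image_grp) : (val h * val g)%g \in image_grp.
Proof.
case: (set_valP h) (set_valP g) => [h' _ <-] [g' _ <-].
by apply/mem_set; exists (h' * g')%g => //; rewrite gmulfM.
Qed.

Definition image_mul (h g : image_grp) : image_grp := SigSub (image_mulP h g).

Lemma image_invP (h : image_grp) : (val h)^-1%g \in image_grp.
Proof.
case: (set_valP h) => [h' _ <-].
apply/mem_set; exists h'^-1%g => //; apply: (mulgI (rho h')).
have rho1 : rho 1%g = 1%g.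
  by apply: (mulgI (rho 1%g)); rewrite mulg1 -gmulfM mulg1.
by rewrite -gmulfM !mulgV rho1.
Qed.

Definition image_inv (h : image_grp) : image_grp := SigSub (image_invP h).

Lemma image_ofP (g : Gam) : rho g \in image_grp.
Proof. by apply/mem_set; exists g. Qed.

Definition image_of (g : Gam) : image_grp := SigSub (image_ofP g).

Context (Om : domain).

Lemma dom_actP (g : image_grp) (m : Om) : hact (val g) (val m) \in dom Om.
Proof.
have [g' _ <-] := set_valP g.
by apply/mem_set/dom_inv; exact: set_valP.
Qed.

Definition dom_act (g : image_grp) (m : Om) : Om := SigSub (dom_actP g m).

Lemma dom_actK g : cancel (dom_act g) (dom_act (image_inv g)).
Proof. by move=> m; apply/val_inj; rewrite /= hactK. Qed.

Lemma dom_actVK g : cancel (dom_act (image_inv g)) (dom_act g).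
Proof. by move=> m; apply/val_inj; rewrite /= hactVK. Qed.

Lemma dom_act_smooth g : smooth_map (dom_act g).
Proof. by apply: (restrict_smooth (F := hact (val g))) => //; exact: hact_smooth. Qed.

Definition dom_diffeo (g : image_grp) : diffeo (Om : Type) :=
  Diffeo (dom_actK g) (dom_actVK g) (dom_act_smooth g)
    (dom_act_smooth (image_inv g)).

Lemma dom_actM h g m : dom_diffeo (image_mul h g) m = dom_diffeo h (dom_diffeo g m).
Proof. by apply/val_inj; rewrite /= hactM. Qed.

Context (D : connection (@idfun Om)).

(* E^g is the pullback of TM, M = Om, by dom_diffeo g. *)
Definition base_conn (g : image_grp) : connection (dom_diffeo g) :=
  push_conn (g := dom_diffeo g) (chi := dom_diffeo g) (fun=> erefl) D.

Definition component (g : image_grp) : topologicalType := moduli (base_conn g).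

Definition coproduct : topologicalType := {g : image_grp & component g}.

Definition coproduct_act (h : image_grp) (p : coproduct) : coproduct :=
  existT component (image_mul h (projT1 p))
    (gauge_class (base_conn _)
       (push_conn (dom_actM h (projT1 p)) (gauge_repr (projT2 p)))).

Lemma coproduct_act_class h g (D' : connection (dom_diffeo g)) :
  coproduct_act h (existT component g (gauge_class (base_conn g) D')) =
  existT component (image_mul h g)
    (gauge_class (base_conn _) (push_conn (dom_actM h g) D')).
Proof.
congr existT; apply/gauge_classP.
have /gauge_classP/gauge_equiv_inv/asboolP[t tD] :=
  gauge_reprK (gauge_class (base_conn g) D').
apply/gauge_equiv_inv/asboolP; exists (push_gauge (dom_actM h g) t).
by rewrite -push_gauge_act tD.
Qed.

Lemma component_eq g1 g2 (D1 : connection (dom_diffeo g1))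
    (D2 : connection (dom_diffeo g2)) : g1 = g2 ->
  (forall X s1 s2, secval s1 = secval s2 -> secval (D1 X s1) = secval (D2 X s2)) ->
  existT component g1 (gauge_class (base_conn g1) D1) =
  existT component g2 (gauge_class (base_conn g2) D2).
Proof.
move=> g12; subst g2 => D12; suff -> : D1 = D2 by [].
by apply: connection_ext => X s; apply/val_inj; exact: D12.
Qed.

Lemma coproduct_actM h h' p :
  coproduct_act (image_mul h h') p = coproduct_act h (coproduct_act h' p).
Proof.
case: p => g q; rewrite -[q]gauge_reprK !coproduct_act_class.
apply: component_eq => [|X s1 s2 s12]; first by apply/val_inj; rewrite /= mulgA.
apply/funext => m; apply/funext => f /=.
rewrite gauge_reprK.
have -> : pull_sec (dom_actM (image_mul h h') g) s1 =
          pull_sec (dom_actM h' g) (pull_sec (dom_actM h (image_mul h' g)) s2).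
  apply/val_inj/funext => m'; apply/funext => k /=; rewrite s12.
  congr (secval s2 m' _); apply/funext => x /=; congr k; apply/val_inj.
  by rewrite /= invgM hactM.
by congr (secval _ m _); apply/funext => x /=; congr f; apply/val_inj; rewrite /= hactM.
Qed.

Lemma coproduct_act1 p : coproduct_act (image_of 1%g) p = p.
Proof.
have rho1 : rho 1%g = 1%g.
  by apply: (mulgI (rho 1%g)); rewrite mulg1 -gmulfM mulg1.
case: p => g q; rewrite -[q]gauge_reprK coproduct_act_class.
apply: component_eq => [|X s1 s2 s12]; first by apply/val_inj; rewrite /= rho1 mul1g.
apply/funext => m; apply/funext => f /=.
have -> : pull_sec (dom_actM (image_of 1%g) g) s1 = s2.
  apply/val_inj/funext => m'; apply/funext => k /=; rewrite s12.
  congr (secval s2 m' _); apply/funext => x /=; congr k; apply/val_inj.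
  by rewrite /= rho1 invg1 hact1.
by congr (secval _ m _); apply/funext => x /=; congr f; apply/val_inj; rewrite /= rho1 hact1.
Qed.

End domain.

(* Main.v *)
(** A compact subset of a coproduct meets finitely many summands, say those
    indexed by [g] in [F]. If [gamma] moves a point of the summand of [g] into
    that of [g'], then [rho gamma * g = g'], so that, for a point [m] of the
    domain of discontinuity, [gamma] moves [g m] to [g' m]. The finite set
    [F m] is compact, hence only finitely many [gamma] do so. *)
Require Import Defs.
From mathcomp Require Import all_boot all_order all_algebra.
From mathcomp Require Import all_classical all_reals all_analysis.

Local Open Scope classical_set_scope.

Lemma sigT_compact_summands {I : choiceType} {X : I -> topologicalType}
    (K : set {i : I & X i}) :
  compact K -> finite_set [set projT1 p | p in K].
Proof.
(* [I] with its cofinite filter stands for the cover by the summands: [K] lies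
   outside almost every one of them. *)
pose cofinite : set_system I := [set A | finite_set (~` A)].
have cofinite_filter : Filter cofinite.
  split=> [|A B fA fB|A B AB]; rewrite /cofinite/=.
  - by rewrite setCT; exact: finite_set0.
  - by rewrite setCI finite_setU.
  - by apply: sub_finite_set; exact: subsetC.
move=> /compact_near_coveringP cK.
(* The complement of this set contains the index of every point of [K]. *)
suff: cofinite [set i | K `<=` [set p | projT1 p <> i]].
  by apply: sub_finite_set => _ [p Kp <-] /(_ p Kp).
apply: (cK I cofinite (fun i p => projT1 p <> i)) => p _.
(* The whole summand of [p] is an open neighbourhood of [p], and it avoids all indices but one. *)
exists ([set q | projT1 q = projT1 p], [set i | i <> projT1 p]).
  split; last by apply: sub_finite_set (finite_set1 (projT1 p)) => i /contrapT.
  apply: open_nbhs_nbhs; split=> //; apply/sigT_openP => i.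
  have [->|ip] := pselect (i = projT1 p).
    by rewrite (_ : _ @^-1` _ = setT); [exact: openT|exact/seteqP].
  by rewrite (_ : _ @^-1` _ = set0); [exact: open0|apply/seteqP; split].
by move=> [q i] /= [-> /nesym].
Qed.

Theorem corollary3p3 (R : realType) (G : lieGroupType R)
    (Gam : groupType) (S : seq Gam) (Gamhat : flow_space (R := R) S)
    (rho : {multiplicative Gam -> G}) (Pp Pm H : subgroup G)
    (Om : domain rho H) (D : connection (@idfun (dom Om))) :
  semisimple G ->
  hyperbolic_group (R := R) S ->
  opposite_parabolics Pp Pm ->
  anosov rho Gamhat Pp Pm ->
  parabolic H \/ symmetric_subgroup H ->
  dom Om !=set0 ->
  properly_discontinuous
    (fun g : Gam => coproduct_act (D := D) (image_of rho g)).
Proof.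
move=> _ _ _ _ _ [m Om_m] K /sigT_compact_summands finK.
pose Km := [set hact (val g) m | g in [set projT1 p | p in K]].
have Km_Om : Km `<=` dom Om.
  by move=> _ [g _ <-]; have [g' _ <-] := set_valP g; exact: dom_inv.
apply: sub_finite_set (dom_finite (finite_compact (finite_image _ finK)) Km_Om).
move=> g /= [_ [[p Kp <-] Kgp]]; exists (hact (rho g * val (projT1 p))%g m).
split.
  exists (hact (val (projT1 p)) m); last by rewrite hactM.
  by exists (projT1 p) => //; exists p.
(* By computation the index of [q] is [rho g] times that of [p]; as [q] lies in [K], the chosen
   point lies in [Km] too. *)
pose q := coproduct_act (D := D) (image_of rho g) p.
by exists (projT1 q) => //; exists q.
Qed.
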